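(* Let $(X,d)$ be an $\mathcal{F}$-metric space, equipped with its $\mathcal{F}$-metric topology $\tau_{\mathcal{F}}$. If $(X,\tau_{\mathcal{F}})$ is separable (i.e. has a countable dense subset), then $(X,\tau_{\mathcal{F}})$ is second countable.
   Context: Let $\mathcal{F}$ be the set of functions $f:[0,\infty)\to\mathbb{R}$ such that: ($\mathcal{F}_1$) $f$ is non-decreasing, i.e. $0<s<t\Rightarrow f(s)\le f(t)$; ($\mathcal{F}_2$) for every sequence $\{t_n\}\subseteq(0,\infty)$, $\lim_{n\to\infty}t_n=0 \iff \lim_{n\to\infty}f(t_n)=-\infty$. Let $X$ be a non-empty set and $d:X\times X\to[0,\infty)$ a map. Then $d$ is an $\mathcal{F}$-metric on $X$, and $(X,d)$ is an $\mathcal{F}$-metric space, if there exists $(f,\alpha)\in\mathcal{F}\times[0,\infty)$ such that: (D1) for all $x,y\in X$, $d(x,y)=0\iff x=y$; (D2) $d(x,y)=d(y,x)$ for all $x,y\in X$; (D3) for every $(x,y)\in X\times X$, every $N\in\mathbb{N}$ with $N\ge 2$, and every $(u_i)_{i=1}^N\subseteq X$ with $(u_1,u_N)=(x,y)$, we have $d(x,y)>0\Rightarrow f(d(x,y))\le f\big(\sum_{i=1}^{N-1}d(u_i,u_{i+1})\big)+\alpha$. For $x\in X$ and $r>0$ put $B(x,r)=\{y\in X: d(x,y)<r\}$. A set $U\subseteq X$ is $\mathcal{F}$-open if for every $x\in U$ there is $r>0$ with $B(x,r)\subseteq U$; the $\mathcal{F}$-open sets form the topology $\tau_{\mathcal{F}}$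 on $X$. *)

(* Defs.v *)
From HB Require Import structures.
From mathcomp Require Import all_boot all_order all_algebra.
From mathcomp Require Import all_classical all_reals all_analysis.

Set Implicit Arguments.
Unset Strict Implicit.
Unset Printing Implicit Defensive.

Import Order.TTheory GRing.Theory Num.Theory.
Import numFieldNormedType.Exports.

Local Open Scope classical_set_scope.
Local Open Scope ring_scope.

(* A function [0, +oo[ -> R is represented by a total function R -> R of which
   only the values on ]0, +oo[ are constrained. In [Fmetric], f is only applied
   to d x y > 0 and to lengths of chains joining x to y, which are then
   positive as well, so the values of f on ]-oo, 0] play no role. *)
Definition classF (R : realType) : set (R -> R) :=
  [set f | (forall s t : R, 0 < s -> s < t -> f s <= f t) /\
           (forall t : nat -> R, (forall n, 0 < t n) ->
              ((t n @[n --> \oo] --> (0 : R)) <->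
               (f (t n) @[n --> \oo] --> -oo)))].

(* The chain u_1, ..., u_N is the restriction of u : nat -> X to {1, ..., N}. *)
Definition Fmetric_axiom (R : realType) (X : Type) (d : X -> X -> R)
    (f : R -> R) (alpha : R) : Prop :=
  forall (x y : X) (N : nat) (u : nat -> X),
    (2 <= N)%N -> u 1%N = x -> u N = y ->
    0 < d x y ->
    f (d x y) <= f (\sum_(1 <= i < N) d (u i) (u i.+1)) + alpha.

Record Fmetric (R : realType) (X : Type) (d : X -> X -> R) : Prop := {
  Fmetric_ge0 : forall x y, 0 <= d x y ;
  Fmetric_fun : exists (f : R -> R) (alpha : R),
    [/\ classF f, 0 <= alpha,
        forall x y, d x y = 0 <-> x = y,
        forall x y, d x y = d y x &
        Fmetric_axiom d f alpha]
}.

Definition Fball (R : realType) (X : Type) (d : X -> X -> R) (x : X) (r : R) :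
  set X := [set y | d x y < r].

Definition Fopen (R : realType) (X : Type) (d : X -> X -> R) : set (set X) :=
  [set U | forall x, U x -> exists2 r : R, 0 < r & Fball d x r `<=` U].

(* [Fspace d] is X equipped with the topology whose open sets are the sets in
   [Fopen d]. These form a topology for every function d. *)
Definition Fspace (R : realType) (X : Type) (d : X -> X -> R) : Type := X.

Section Fspace_topology.
Context (R : realType) (X : Type) (d : X -> X -> R).

HB.instance Definition _ := gen_eqMixin (Fspace d).
HB.instance Definition _ := gen_choiceMixin (Fspace d).

Lemma FopenT : Fopen d setT.
Proof. by move=> x _; exists 1. Qed.

Lemma FopenI : setI_closed (Fopen d).
Proof.
move=> A B oA oB x [/oA[r r0 rA] /oB[s s0 sB]].
exists (Num.min r s); first by rewrite lt_min r0.
move=> y; rewrite /Fball /= lt_min => /andP[yr ys].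
by split; [exact: rA|exact: sB].
Qed.

Lemma Fopen_bigU (I : Type) (F : I -> set X) :
  (forall i, Fopen d (F i)) -> Fopen d (\bigcup_i F i).
Proof.
move=> oF x [i _ /oF[r r0 rF]]; exists r => // y /rF Fy.
by exists i.
Qed.

HB.instance Definition _ := @isOpenTopological.Build (Fspace d) (Fopen d)
  FopenT FopenI Fopen_bigU.

Lemma open_FspaceE : @open (Fspace d) = Fopen d.
Proof. by []. Qed.

End Fspace_topology.

Definition separable (T : topologicalType) : Prop :=
  exists2 A : set T, countable A & dense A.

(* Main.v *)
Require Import Defs.
From mathcomp Require Import all_boot all_order all_algebra.
From mathcomp Require Import all_classical all_reals all_analysis.

(** An F-metric satisfies a uniform weak triangle inequality: by (D3) for chains
    of three points and (F2), [d x z] is small as soon as [d x y] and [d y z]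
    are. Hence, although balls need not be open, they are neighbourhoods of
    their centre, and the interiors of the balls of radius [1/(n+1)] centred at
    the points of a countable dense set form a countable basis. *)

Set Implicit Arguments.
Unset Strict Implicit.
Unset Printing Implicit Defensive.

Import Order.TTheory GRing.Theory Num.Theory.
Import numFieldNormedType.Exports.

Local Open Scope classical_set_scope.
Local Open Scope ring_scope.

(** By (F2), the images under [f] of the terms [1/(n+1)] tend to [-oo]. *)
Lemma classF_small (R : realType) (f : R -> R) (M : R) :
  classF f -> exists2 e : R, 0 < e & f e < M.
Proof.
move=> [_ F2]; have /F2 h : forall n, 0 < @harmonic R n := harmonic_gt0.
have /cvgrNyPlt/(_ M) := h.1 cvg_harmonic.
by move=> /filter_ex[n fn]; exists (harmonic n) => //; exact: harmonic_gt0.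
Qed.

Section Fmetric_theory.
Context (R : realType) (X : Type) (d : X -> X -> R) (hd : Fmetric d).

Lemma Fmetric_xx x : d x x = 0.
Proof. by have [f [a [_ _ d0 _ _]]] := Fmetric_fun hd; apply/d0. Qed.

Lemma Fmetric_sym x y : d x y = d y x.
Proof. by have [f [a [_ _ _ dC _]]] := Fmetric_fun hd. Qed.

Lemma Fmetric_weak_triangle (e : R) : 0 < e ->
  exists2 r : R, 0 < r & forall x y z, d x y < r -> d y z < r -> d x z < e.
Proof.
move=> e0; have [f [a [Ff a0 d0 _ D3]]] := Fmetric_fun hd.
(* With this [s], [e <= d x z] would give [f e <= f (d x z) <= f (d x y + d y z) + a <= f s + a < f
   e]. *)
have [s s0 fs] := classF_small (f e - a) Ff.
exists (s / 2); first by rewrite divr_gt0.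
move=> x y z dxy dyz; rewrite ltNge; apply/negP => edxz.
have dxz0 : 0 < d x z by exact: lt_le_trans edxz.
(* Chains are indexed from 1, so the entry at index 0 is a dummy. *)
have := D3 x z 3 (fun i => nth x [:: x; x; y; z] i) isT erefl erefl dxz0.
rewrite big_nat_recr//= big_nat1/=.
(* (F1) compares values at positive arguments only; a zero sum would force [x = y = z]. *)
have dxyz0 : 0 < d x y + d y z.
  rewrite lt_neqAle addr_ge0 ?(Fmetric_ge0 hd)// andbT eq_sym.
  rewrite paddr_eq0 ?(Fmetric_ge0 hd)//; apply/negP => /andP[/eqP/d0 xy /eqP/d0 yz].
  by move: dxz0; rewrite xy yz Fmetric_xx ltxx.
have dxyzs : d x y + d y z < s by rewrite [s]splitr ltrD.
have fxyz := Ff.1 _ _ dxyz0 dxyzs.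
have fe : f e <= f (d x z).
  by move: edxz; rewrite le_eqVlt => /predU1P[->//|]; exact: Ff.1.
apply/negP; rewrite -ltNge (lt_le_trans _ fe)// -ltrBrDr.
exact: le_lt_trans fxyz fs.
Qed.

Lemma nbhs_FspaceP (x : Fspace d) (A : set (Fspace d)) :
  nbhs x A <-> exists2 r : R, 0 < r & Fball d x r `<=` A.
Proof.
split=> [|[r r0 rA]].
  rewrite nbhsE => -[U [oU Ux] UA].
  have [r r0 rU] := oU _ Ux.
  by exists r => //; exact: subset_trans UA.
rewrite nbhsE.
(* The points with some ball inside [A] form an open set: if two steps shorter than [t] stay within
   [s], every point of the [t]-ball has its own [t]-ball inside [A]. *)
exists [set y | exists2 s : R, 0 < s & Fball d y s `<=` A]; last first.
  by move=> y [s s0]; apply; rewrite /Fball/= Fmetric_xx.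
split; last by exists r.
move=> y [s s0 sA]; have [t t0 tri] := Fmetric_weak_triangle s0.
exists t => // z yz; exists t => // w zw; apply: sA.
exact: tri yz zw.
Qed.

Lemma Fball_interior_basis (A : set (Fspace d)) : dense A ->
  basis [set (Fball d p.1 (harmonic p.2) : set (Fspace d))° |
         p in A `*` [set: nat]].
Proof.
move=> dA; split=> [_ [p _ <-]|x U /nbhs_FspaceP[r r0 rU]].
  exact: open_interior.
(* A point [a] of the dense set must be [s]-close to [x], so that its ball of radius [1/(n+1) < s]
   stays in [U], and [t]-close, so that [x] is interior to that ball. *)
have [s s0 tri_s] := Fmetric_weak_triangle r0.
have [n ns] := filter_ex (near_infty_natSinv_lt (PosNum s0)).
have [t t0 tri_t] := Fmetric_weak_triangle (@harmonic_gt0 R n).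
have m0 : 0 < Num.min s t by rewrite lt_min s0.
have : nbhs (x : Fspace d) (Fball d x (Num.min s t)).
  by apply/nbhs_FspaceP; exists (Num.min s t).
move=> xm.
(* Density applies to open sets only, hence the interior, which contains [x]. *)
have [||a [/interior_subset + Aa]] := dA (Fball d x (Num.min s t) : set (Fspace d))°.
- by exists x.
- exact: open_interior.
rewrite /Fball/= lt_min => /andP[xas xat].
exists (Fball d a (harmonic n) : set (Fspace d))°.
  split; first by exists (a, n).
  apply/nbhs_FspaceP; exists t => // y xy.
  by apply: (tri_t _ x) => //; rewrite Fmetric_sym.
apply: subset_trans (@interior_subset (Fspace d) _) _ => y ay; apply: rU.
exact: tri_s xas (lt_trans ay ns).
Qed.

End Fmetric_theory.

Theorem theorem2p4 (R : realType) (X : Type) (hX : inhabited X)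
    (d : X -> X -> R) (hd : Fmetric d) :
  separable (Fspace d) -> @second_countable (Fspace d).
Proof.
move=> [A cA dA]; eexists; last exact: (Fball_interior_basis hd dA).
(* The basis is an image of the countable set [A * nat]. *)
exact/(sub_countable (card_image_le _ _))/countableX.
Qed.
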